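(* Suppose assumptions (A1) and (A2) of the context hold, and consider the RCD algorithm (described in the context) with $S=1$, with $K\ge 1$ outer iterations, and with each index $\ell_k^s$ selected uniformly at random from $\mathcal I$. If $\eta=\frac{1}{L c_b}$, then $$\min_{0\le k\le K-1}\mathbb E\,\|\mathrm{grad} f(X_k)\|_{X_k}^2\;\le\;\frac{2L\,c_b^2\,c_p^{-1}\,|\mathcal I|\,\Delta_0}{K},\qquad \Delta_0:=f(X_0)-f^*.$$
   Context: Setting. $\mathcal M$ is a Riemannian manifold of matrices embedded in a Euclidean matrix space $\mathbb R^{m\times n}$, with Riemannian metric $\langle\cdot,\cdot\rangle_X$ and norm $\|\cdot\|_X$ on $T_X\mathcal M$; $\langle\cdot,\cdot\rangle$ without subscript is the Euclidean (Frobenius) inner product. $f:\mathcal M\to\mathbb R$ is differentiable with Euclidean gradient $\nabla f(X)$, and the Riemannian gradient $\mathrm{grad} f(X)\in T_X\mathcal M$ is defined by $\langle \mathrm{grad} f(X),U\rangle_X=\langle\nabla f(X),U\rangle$ for all $U\in T_X\mathcal M$. A retraction is a map $\mathrm{Retr}_X:T_X\mathcal M\to\mathcal M$ with $\mathrm{Retr}_X(0)=X$ and $\mathrm D\,\mathrm{Retr}_X(0)[U]=U$. $\mathcal I$ is a finite index set, and for each $X$ there are tangent vectors $B_{\ell,X}\in T_X\mathcal M$, $\ell\in\mathcal I$, spanning $T_X\mathcal M$ (called the basis; not necessarily orthonormal or linearly independent). $f^*$ denotes the minimum value of $f$ on $\mathcal M$. RCD algorithm. Given $X_0\in\mathcal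 M$, positive integers $K,S$ and stepsize $\eta>0$: for $k=0,\dots,K-1$, set $X_k^0=X_k$; for $s=0,\dots,S-1$ pick an index $\ell_k^s\in\mathcal I$, set $\theta_k^s=\langle\nabla f(X_k^s),B_{\ell_k^s,X_k^s}\rangle$ and $X_k^{s+1}=\mathrm{Retr}_{X_k^s}(-\eta\,\theta_k^s\,B_{\ell_k^s,X_k^s})$; then set $X_{k+1}=X_k^S$. Assumptions. $\mathcal X\subseteq\mathcal M$ is a compact neighbourhood containing a critical point of $f$, and all iterates remain in $\mathcal X$. Write $\mathcal P_{B_{\ell,X}}(U):=\langle U,B_{\ell,X}\rangle_X B_{\ell,X}$. (A1) There are constants $c_b,c_p>0$ such that for all $X\in\mathcal X$, $U\in T_X\mathcal M$, $\ell\in\mathcal I$: $\|B_{\ell,X}\|_X^2\le c_b$ and $\sum_{\ell\in\mathcal I}\|\mathcal P_{B_{\ell,X}}U\|_X^2\ge c_p\|U\|_X^2$. (A2) There is $L>0$ such that $f(\mathrm{Retr}_X(U))-f(X)-\langle\mathrm{grad} f(X),U\rangle_X\le\frac L2\|U\|_X^2$ for all $X\in\mathcal X$ and $U\in T_X\mathcal M$ with $\mathrm{Retr}_X(U)\in\mathcal X$. *)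

(* Defs.v *)
From HB Require Import structures.
From mathcomp Require Import all_boot all_order all_algebra.
From mathcomp Require Import all_classical all_reals all_analysis.

Set Implicit Arguments.
Unset Strict Implicit.
Unset Printing Implicit Defensive.

Import Order.TTheory GRing.Theory Num.Theory.
Import numFieldNormedType.Exports.

Local Open Scope classical_set_scope.
Local Open Scope ring_scope.

(* On an open subset [U] of a finite-dimensional space, [F] is C^k iff all its
   iterated directional derivatives up to order k exist and those of order k
   are continuous.  Both spaces are finite-dimensional wherever this is used. *)
Fixpoint Ck (R : realType) (V W : normedModType R) (k : nat)
    (U : set V) (F : V -> W) : Prop :=
  match k with
  | 0 => forall x, U x -> {for x, continuous F}
  | k'.+1 => forall v : V,
      (forall x, U x -> derivable F x v) /\ Ck k' U (fun x => 'D_v F x)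
  end.

Definition smooth (R : realType) (V W : normedModType R)
    (U : set V) (F : V -> W) : Prop := forall k, Ck k U F.

(* [M] is locally the zero set of a smooth submersion to R^q; the codimension
   [q] is the same everywhere, and q = 0 gives the open subsets. *)
Definition embedded_submanifold (R : realType) (m n : nat)
    (M : set 'M[R]_(m, n)) : Prop :=
  exists q : nat, forall X, M X ->
    exists (U : set 'M[R]_(m, n)) (h : 'M[R]_(m, n) -> 'rV[R]_q),
      [/\ open U, U X, smooth U h,
          forall Y, U Y -> (M Y <-> h Y = 0) &
          range ('d h X) = setT].

Definition tangent (R : realType) (m n : nat) (M : set 'M[R]_(m, n))
    (X : 'M[R]_(m, n)) : set 'M[R]_(m, n) :=
  [set V | exists (e : R) (c : R -> 'M[R]_(m, n)),
     [/\ 0 < e, smooth (`]- e, e[%classic : set R) c,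
         forall t, - e < t < e -> M (c t), c 0 = X & is_derive (0 : R) (1 : R) c V]].

(* A map on the embedded submanifold [M] is smooth when it locally extends to
   a smooth map on an open subset of the ambient space. *)
Definition smooth_on_submanifold (R : realType) (m n : nat)
    (W : normedModType R) (M : set 'M[R]_(m, n))
    (F : 'M[R]_(m, n) -> W) : Prop :=
  forall X, M X -> exists (U : set 'M[R]_(m, n)) (G : 'M[R]_(m, n) -> W),
    [/\ open U, U X, smooth U G & forall Y, U Y -> M Y -> G Y = F Y].

Definition smooth_vector_field (R : realType) (m n : nat)
    (M : set 'M[R]_(m, n)) (V : 'M[R]_(m, n) -> 'M[R]_(m, n)) : Prop :=
  smooth_on_submanifold M V /\ (forall X, M X -> tangent M X (V X)).

(* [g X U V] stands for <U, V>_X; its values are only meaningful when [X] is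
   in [M] and [U], [V] are tangent to [M] at [X]. *)
Definition riemannian_metric (R : realType) (m n : nat)
    (M : set 'M[R]_(m, n))
    (g : 'M[R]_(m, n) -> 'M[R]_(m, n) -> 'M[R]_(m, n) -> R) : Prop :=
  [/\ forall X, M X -> forall U V, tangent M X U -> tangent M X V ->
        g X U V = g X V U,
      forall X, M X -> forall (a : R) U V W,
        tangent M X U -> tangent M X V -> tangent M X W ->
        g X (a *: U + V) W = a * g X U W + g X V W,
      forall X, M X -> forall U, tangent M X U -> U <> 0 -> 0 < g X U U &
      forall V W, smooth_vector_field M V -> smooth_vector_field M W ->
        smooth_on_submanifold M (fun X => g X (V X) (W X) : R)].

Definition rnorm (R : realType) (m n : nat)
    (g : 'M[R]_(m, n) -> 'M[R]_(m, n) -> 'M[R]_(m, n) -> R)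
    (X U : 'M[R]_(m, n)) : R := Num.sqrt (g X U U).

Definition frobenius (R : realType) (m n : nat) (A B : 'M[R]_(m, n)) : R :=
  \tr (A^T *m B).

Definition egrad (R : realType) (m n : nat) (f : 'M[R]_(m, n) -> R)
    (X : 'M[R]_(m, n)) : 'M[R]_(m, n) :=
  \matrix_(i < m, j < n) 'D_(delta_mx i j) f X.

Definition is_rgrad (R : realType) (m n : nat) (M : set 'M[R]_(m, n))
    (g : 'M[R]_(m, n) -> 'M[R]_(m, n) -> 'M[R]_(m, n) -> R)
    (f : 'M[R]_(m, n) -> R) (rgrad : 'M[R]_(m, n) -> 'M[R]_(m, n)) : Prop :=
  forall X, M X -> tangent M X (rgrad X) /\
    forall U, tangent M X U -> g X (rgrad X) U = frobenius (egrad f X) U.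

(* The last clause is D Retr_X(0)[U] = U; the directional derivative at 0 along
   a tangent [U] only involves values of [Retr X] on the line spanned by [U]. *)
Definition retraction (R : realType) (m n : nat) (M : set 'M[R]_(m, n))
    (Retr : 'M[R]_(m, n) -> 'M[R]_(m, n) -> 'M[R]_(m, n)) : Prop :=
  forall X, M X ->
    [/\ forall U, tangent M X U -> M (Retr X U),
        Retr X 0 = X &
        forall U, tangent M X U ->
          is_derive (0 : 'M[R]_(m, n)) U (Retr X) U].

Definition spans_tangent (R : realType) (m n : nat) (I : finType)
    (M : set 'M[R]_(m, n)) (B : I -> 'M[R]_(m, n) -> 'M[R]_(m, n)) : Prop :=
  forall X, M X ->
    tangent M X = [set U | (U \in <<[seq B l X | l : I]>>%VS)].

Definition is_minimum (R : realType) (T : Type) (M : set T) (f : T -> R)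
    (fstar : R) : Prop :=
  (exists2 X, M X & f X = fstar) /\ (forall X, M X -> fstar <= f X).

(* A neighbourhood in the topology of [M] of one of its points. *)
Definition compact_neighbourhood_in (R : realType) (m n : nat)
    (M XX : set 'M[R]_(m, n)) : Prop :=
  [/\ XX `<=` M, compact XX & exists2 Y, M Y & within M (nbhs Y) XX].

Definition coord_proj (R : realType) (m n : nat) (I : finType)
    (g : 'M[R]_(m, n) -> 'M[R]_(m, n) -> 'M[R]_(m, n) -> R)
    (B : I -> 'M[R]_(m, n) -> 'M[R]_(m, n)) (l : I)
    (X U : 'M[R]_(m, n)) : 'M[R]_(m, n) := g X U (B l X) *: B l X.

Definition basis_bounds (R : realType) (m n : nat) (I : finType)
    (M XX : set 'M[R]_(m, n))
    (g : 'M[R]_(m, n) -> 'M[R]_(m, n) -> 'M[R]_(m, n) -> R)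
    (B : I -> 'M[R]_(m, n) -> 'M[R]_(m, n)) (cb cp : R) : Prop :=
  forall X, XX X ->
    (forall l, rnorm g X (B l X) ^+ 2 <= cb) /\
    (forall U, tangent M X U ->
      cp * rnorm g X U ^+ 2 <= \sum_(l : I) rnorm g X (coord_proj g B l X U) ^+ 2).

Definition retraction_smooth (R : realType) (m n : nat)
    (M XX : set 'M[R]_(m, n))
    (g : 'M[R]_(m, n) -> 'M[R]_(m, n) -> 'M[R]_(m, n) -> R)
    (Retr : 'M[R]_(m, n) -> 'M[R]_(m, n) -> 'M[R]_(m, n))
    (f : 'M[R]_(m, n) -> R) (rgrad : 'M[R]_(m, n) -> 'M[R]_(m, n))
    (L : R) : Prop :=
  forall X U, XX X -> tangent M X U -> XX (Retr X U) ->
    f (Retr X U) - f X - g X (rgrad X) U <= L / 2 * rnorm g X U ^+ 2.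

Definition rcd_step (R : realType) (m n : nat) (I : finType)
    (Retr : 'M[R]_(m, n) -> 'M[R]_(m, n) -> 'M[R]_(m, n))
    (f : 'M[R]_(m, n) -> R) (B : I -> 'M[R]_(m, n) -> 'M[R]_(m, n))
    (eta : R) (X : 'M[R]_(m, n)) (l : I) : 'M[R]_(m, n) :=
  let theta := frobenius (egrad f X) (B l X) in
  Retr X (- (eta * theta) *: B l X).

Fixpoint rcd_inner (T I : Type) (step : T -> I -> T) (l : nat -> I)
    (X : T) (s : nat) : T :=
  if s is s'.+1 then step (rcd_inner step l X s') (l s') else X.

Fixpoint rcd_outer (T I : Type) (step : T -> I -> T) (l : nat -> nat -> I)
    (S : nat) (X0 : T) (k : nat) : T :=
  if k is k'.+1 then rcd_inner step (l k') (rcd_outer step l S X0 k') S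
  else X0.

(* X_k^s for the index selection [l k s] = l_k^s. *)
Definition rcd_iterate (R : realType) (m n : nat) (I : finType)
    (Retr : 'M[R]_(m, n) -> 'M[R]_(m, n) -> 'M[R]_(m, n))
    (f : 'M[R]_(m, n) -> R) (B : I -> 'M[R]_(m, n) -> 'M[R]_(m, n))
    (eta : R) (S : nat) (X0 : 'M[R]_(m, n)) (l : nat -> nat -> I)
    (k s : nat) : 'M[R]_(m, n) :=
  let step := rcd_step Retr f B eta in
  rcd_inner step (l k) (rcd_outer step l S X0 k) s.

(* Mutually independent random elements of the finite set [I], each uniformly
   distributed; every subset of [I] is measurable. *)
Definition independent_uniform (R : realType) (d : measure_display)
    (T : measurableType d) (P : probability T R) (I J : finType)
    (xi : J -> T -> I) : Prop :=
  [/\ forall j (A : set I), measurable (xi j @^-1` A),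
      forall j (i : I), P (xi j @^-1` [set i]) = ((#|I|%:R)^-1 : R)%:E &
      forall (D : {set J}) (A : J -> set I),
        P (\bigcap_(j in [set` D]) (xi j @^-1` A j)) =
        (\prod_(j in D) P (xi j @^-1` A j))%E].

(* Main.v *)
Require Import Defs.
From HB Require Import structures.
From mathcomp Require Import all_boot all_order all_algebra.
From mathcomp Require Import all_classical all_reals all_analysis.
From mathcomp Require Import measurable_realfun ring lra.
Import Order.TTheory GRing.Theory Num.Theory.
Import numFieldNormedType.Exports.
Local Open Scope classical_set_scope.
Local Open Scope ring_scope.

(** Write [theta l X] for the derivative of [f] at [X] along the basis vector
    [B l X], which equals [<grad f(X), B l X>_X].  A step along [B l X] with
    coefficient [- eta * theta] changes [f] by at most
    [- eta * theta^2 + L / 2 * eta^2 * theta^2 * cb] by (A2) and the bound on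
    [B l X]; with [eta = 1 / (L * cb)] this is [- theta^2 / (2 * L * cb)]
    ([rcd_step_descent]).  Telescoping along a single run bounds the sum of the
    squared derivatives actually met by [2 * L * cb * (f X0 - fstar)], whatever
    the indices ([rcd_sum_basis_deriv]).

    On the other side, (A1) bounds [cp * |grad f(X)|^2] by
    [cb * \sum_l theta l X ^ 2] ([rgrad_le_basis_deriv]).  The two sums are
    compared by randomness: the index drawn at step [k] is uniform and
    independent of [X_k], so the expected [theta^2] met at that step is the
    average of [theta l X_k ^ 2] over [l].  Summing over [k] and bounding the
    smallest expectation by the mean gives the claim.

    The probability is entirely finite.  The vector of all drawn indices is
    uniform on the finite set of index vectors ([independent_uniform_joint]),
    so expectations are plain averages over that set
    ([expectation_finite_range]), and the conditioning argument becomes the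
    observation that exchanging coordinate [k] of a vector with a separate index
    is a bijection ([sum_resample]).  Moreover every index vector has positive
    probability, hence is realised by some outcome; this is why the requirement
    that the iterates stay in the compact set, made outcome by outcome, may be
    used for every index vector. *)

Set Implicit Arguments.
Unset Strict Implicit.
Unset Printing Implicit Defensive.

(** * Tangent vectors and the metric *)

Lemma tangent_scale (R : realType) (m n : nat) (M : set 'M[R]_(m, n))
    (I : finType) (B : I -> 'M[R]_(m, n) -> 'M[R]_(m, n)) X a U :
  spans_tangent M B -> M X -> tangent M X U -> tangent M X (a *: U).
Proof. by move=> hB MX; rewrite (hB X MX) /=; exact: memvZ. Qed.

Lemma tangent_basis (R : realType) (m n : nat) (M : set 'M[R]_(m, n))
    (I : finType) (B : I -> 'M[R]_(m, n) -> 'M[R]_(m, n)) X l :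
  spans_tangent M B -> M X -> tangent M X (B l X).
Proof.
move=> hB MX; rewrite (hB X MX) /=.
by apply/memv_span/(map_f (fun i => B i X)); rewrite mem_enum.
Qed.

Lemma metric_scalel (R : realType) (m n : nat) (M : set 'M[R]_(m, n)) g
    X a U W :
  riemannian_metric M g -> M X -> tangent M X 0 -> tangent M X U ->
  tangent M X W -> g X (a *: U) W = a * g X U W.
Proof.
move=> [_ lin _ _] MX T0 TU TW.
have g0 : g X 0 W = 0.
  have := lin X MX 1 0 0 W T0 T0 TW; rewrite scale1r addr0 mul1r => e.
  by apply: (addrI (g X 0 W)); rewrite addr0 -e.
by have := lin X MX a U 0 W TU T0 TW; rewrite addr0 g0 addr0.
Qed.

Lemma rnorm_sq (R : realType) (m n : nat) (M : set 'M[R]_(m, n)) g X U :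
  riemannian_metric M g -> M X -> tangent M X 0 -> tangent M X U ->
  rnorm g X U ^+ 2 = g X U U.
Proof.
move=> hg MX T0 TU; rewrite /rnorm sqr_sqrtr//.
have [->|/eqP U0] := eqVneq U 0.
  by have := metric_scalel 0 hg MX T0 T0 T0; rewrite scale0r mul0r => ->.
by case: hg => _ _ pos _; apply: ltW; exact: pos.
Qed.

Lemma rnorm_scale_sq (R : realType) (m n : nat) (M : set 'M[R]_(m, n)) g
    X a U :
  riemannian_metric M g -> M X -> (forall b, tangent M X (b *: U)) ->
  rnorm g X (a *: U) ^+ 2 = a ^+ 2 * rnorm g X U ^+ 2.
Proof.
move=> hg MX TU.
have T0 : tangent M X 0 by have := TU 0; rewrite scale0r.
have T1 : tangent M X U by have := TU 1; rewrite scale1r.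
rewrite !(rnorm_sq hg MX T0)//.
have [symm _ _ _] := hg.
rewrite (metric_scalel a hg)// symm// (metric_scalel a hg)//.
by ring.
Qed.

(** * One run of the algorithm *)

Definition basis_deriv (R : realType) (m n : nat) (I : finType)
    (f : 'M[R]_(m, n) -> R) (B : I -> 'M[R]_(m, n) -> 'M[R]_(m, n))
    (X : 'M[R]_(m, n)) (l : I) : R := frobenius (egrad f X) (B l X).

(** The stepsize [1 / (L * cb)] minimises the upper bound
    [- eta * theta^2 + L / 2 * eta^2 * theta^2 * cb] on the change of [f], and
    the minimum is [- theta^2 / (2 * L * cb)]. *)
Lemma rcd_step_descent (R : realType) (m n : nat) (M XX : set 'M[R]_(m, n))
    g f rgrad Retr (I : finType) (B : I -> 'M[R]_(m, n) -> 'M[R]_(m, n))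
    (cb cp L : R) X l :
  riemannian_metric M g -> is_rgrad M g f rgrad -> spans_tangent M B ->
  XX `<=` M -> 0 < cb -> 0 < L ->
  basis_bounds M XX g B cb cp -> retraction_smooth M XX g Retr f rgrad L ->
  XX X -> XX (rcd_step Retr f B (1 / (L * cb)) X l) ->
  basis_deriv f B X l ^+ 2 <=
    2 * L * cb * (f X - f (rcd_step Retr f B (1 / (L * cb)) X l)).
Proof.
move=> hg hgrad hB sXM cb0 L0 hA1 hA2 XXX.
rewrite /rcd_step -/(basis_deriv f B X l).
set th := basis_deriv _ _ _ _; set t := _ * th => XXR.
have MX := sXM X XXX.
have TB b : tangent M X (b *: B l X).
  by apply: tangent_scale (hB) _ _ => //; exact: tangent_basis.
have T0 : tangent M X 0 by have := TB 0; rewrite scale0r.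
have T1 : tangent M X (B l X) by have := TB 1; rewrite scale1r.
have [TG gradE] := hgrad X MX.
have := hA2 X _ XXX (TB _) XXR.
have [symm _ _ _] := hg.
rewrite (rnorm_scale_sq _ hg)// symm// (metric_scalel _ hg)// symm// gradE//.
rewrite -/(basis_deriv f B X l) -/th.
have [/(_ l) hb _] := hA1 X XXX.
set b := rnorm _ _ _ ^+ 2 in hb *; set fY := f (Retr _ _) => step.
have Lcb : 0 < L * cb by exact: mulr_gt0.
(* With th expressed through t, step becomes polynomial and no division
   is left for the linear arithmetic below. *)
have ct : th = L * cb * t by rewrite /t; field; apply/andP; split; lra.
have gap : 0 <= L / 2 * t ^+ 2 * (cb - b).
  apply: mulr_ge0; last lra.
  by apply: mulr_ge0 (sqr_ge0 _); lra.
have : L * cb * t ^+ 2 <= 2 * (f X - fY) by rewrite ct in step; lra.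
by move/(ler_wpM2l (ltW Lcb)); rewrite ct; lra.
Qed.

(** The descent inequality bounds each term by a difference of values of [f] at
    consecutive iterates, and these telescope for every index sequence [l]. *)
Lemma rcd_sum_basis_deriv (R : realType) (m n : nat) (M XX : set 'M[R]_(m, n))
    g f rgrad Retr (I : finType) (B : I -> 'M[R]_(m, n) -> 'M[R]_(m, n))
    (cb cp L fstar : R) X0 (l : nat -> nat -> I) (K : nat) :
  let X k := rcd_iterate Retr f B (1 / (L * cb)) 1 X0 l k 0 in
  riemannian_metric M g -> is_rgrad M g f rgrad -> spans_tangent M B ->
  XX `<=` M -> 0 < cb -> 0 < L ->
  basis_bounds M XX g B cb cp -> retraction_smooth M XX g Retr f rgrad L ->
  (forall Y, M Y -> fstar <= f Y) ->
  (forall k, (k <= K)%N -> XX (X k)) ->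
  \sum_(k < K) basis_deriv f B (X k) (l k 0) ^+ 2 <=
    2 * L * cb * (f X0 - fstar).
Proof.
move=> X hg hgrad hB sXM cb0 L0 hA1 hA2 hmin hX.
have Lcb : 0 < 2 * L * cb by rewrite !mulr_gt0.
apply: (@le_trans _ _ (2 * L * cb * (f X0 - f (X K)))); last first.
  by rewrite ler_wpM2l ?(ltW Lcb)// lerB// hmin//; apply/sXM/hX.
elim: K hX => [|K IH] hX; first by rewrite big_ord0 subrr mulr0.
rewrite big_ord_recr /=.
have -> : f X0 - f (X K.+1) = (f X0 - f (X K)) + (f (X K) - f (X K.+1)) by ring.
rewrite mulrDr; apply: lerD.
  by apply: IH => k kK; apply: hX; exact: leqW.
apply: (rcd_step_descent hg hgrad hB sXM cb0 L0 hA1 hA2).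
  by apply: hX; exact: leqnSn.
exact: (hX K.+1).
Qed.

(** The projection of the gradient onto [B l X] has squared norm
    [theta^2 * |B l X|^2], at most [cb * theta^2], so the second half of (A1)
    turns into a bound on the gradient by the derivatives along the basis. *)
Lemma rgrad_le_basis_deriv (R : realType) (m n : nat)
    (M XX : set 'M[R]_(m, n)) g f rgrad
    (I : finType) (B : I -> 'M[R]_(m, n) -> 'M[R]_(m, n)) (cb cp : R) X :
  riemannian_metric M g -> is_rgrad M g f rgrad -> spans_tangent M B ->
  XX `<=` M -> basis_bounds M XX g B cb cp -> XX X ->
  cp * rnorm g X (rgrad X) ^+ 2 <= cb * \sum_l basis_deriv f B X l ^+ 2.
Proof.
move=> hg hgrad hB sXM hA1 XXX.
have MX := sXM X XXX.
have [TG gradE] := hgrad X MX.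
have [hb hp] := hA1 X XXX.
apply: le_trans (hp _ TG) _; rewrite mulr_sumr; apply: ler_sum => l _.
have TB : tangent M X (B l X) by exact: tangent_basis.
rewrite /coord_proj gradE// (rnorm_scale_sq _ hg MX).
  by rewrite mulrC ler_wpM2r// sqr_ge0.
by move=> b; apply: tangent_scale (hB) _ _.
Qed.

Lemma rcd_outer_eq_prefix (T I : Type) (step : T -> I -> T)
    (l l' : nat -> nat -> I) (S : nat) (X0 : T) (k : nat) :
  (forall j s, (j < k)%N -> (s < S)%N -> l j s = l' j s) ->
  rcd_outer step l S X0 k = rcd_outer step l' S X0 k.
Proof.
elim: k => //= k IH h; rewrite IH; last by move=> j s jk; apply: h; exact: ltnW.
move: (rcd_outer _ _ _ _ _) => Y.
have {h} : forall s, (s < S)%N -> l k s = l' k s by move=> s; exact: h.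
by elim: S {IH} => //= S IH h; rewrite IH ?h// => s sS; apply: h; exact: ltnW.
Qed.

(** * Averages over index vectors *)

(** The counting form of: if [F] depends only on the coordinates of a uniform
    vector [x] other than the [k]-th, then [x k] behaves inside [F] like a
    fresh uniform index.  Exchanging [x k] with the separate index [l] is an
    involution on pairs, and it turns [F x l] into [F x (x k)]. *)
Lemma sum_resample (R : nmodType) (I J : finType) (k : J)
    (F : {ffun J -> I} -> I -> R) :
  (forall x y : {ffun J -> I}, (forall j, j != k -> x j = y j) -> F x =1 F y) ->
  \sum_x \sum_l F x l = (\sum_x F x (x k)) *+ #|I|.
Proof.
move=> hF.
pose upd (x : {ffun J -> I}) l := [ffun j => if j == k then l else x j].
have updk x l : upd x l k = l by rewrite ffunE eqxx.
have updN x l j : j != k -> upd x l j = x j by rewrite ffunE => /negbTE ->.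
pose swap (p : {ffun J -> I} * I) := (upd p.1 p.2, p.1 k).
have swapK : involutive swap.
  move=> [x l]; rewrite /swap /= updk; congr (_, _).
  by apply/ffunP => j; rewrite !ffunE; case: eqP => // ->.
rewrite pair_bigA (reindex_inj (inv_inj swapK)) /=.
rewrite -(pair_bigA _ (fun x l => F (upd x l) (x k))) /=.
rewrite -sumrMnl; apply: eq_bigr => x _.
rewrite -sumr_const; apply: eq_bigr => l _.
exact/hF/updN.
Qed.

Lemma exists_le_average (R : realDomainType) (K : nat) (e : 'I_K -> R) c :
  (0 < K)%N -> \sum_k e k <= K%:R * c -> exists k, e k <= c.
Proof.
move=> K0; apply: contraPP => /forallNP h; apply/negP; rewrite -ltNge.
have -> : K%:R * c = \sum_(k < K) c by rewrite sumr_const card_ord mulr_natl.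
apply: ltr_sum => [|k _]; last by rewrite ltNge; apply/negP/h.
by apply/hasP; exists (Ordinal K0); rewrite ?mem_index_enum.
Qed.

Lemma expectation_finite_range (R : realType) (d : measure_display)
    (T : measurableType d) (P : probability T R) (J : finType)
    (h : T -> J) (F : J -> R) :
  (forall x, measurable (h @^-1` [set x])) -> (forall x, 0 <= F x) ->
  ('E_P[F \o h] = \sum_x (F x)%:E * P (h @^-1` [set x]))%E.
Proof.
move=> mh F0; rewrite unlock.
transitivity (\int[P]_w \sum_x ((F x)%:E * (\1_(h @^-1` [set x]) w)%:E))%E.
  apply: eq_integral => w _ /=; rewrite (bigD1 (h w))//= big1 => [|x /eqP xw].
    by rewrite indicE mem_set// mule1 adde0.
  by rewrite indicE memNset ?mule0//= => e; apply: xw.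
rewrite ge0_integral_sum//.
- apply: eq_bigr => x _; rewrite ge0_integralZl ?lee_fin//.
    by rewrite integral_indic// setIT.
  exact/measurable_EFinP/measurable_indic.
- by move=> x; exact/measurable_funeM/measurable_EFinP/measurable_indic.
- by move=> x w _; rewrite mule_ge0 ?lee_fin.
Qed.

Lemma independent_uniform_joint (R : realType) (d : measure_display)
    (T : measurableType d) (P : probability T R) (I J : finType)
    (xi : J -> T -> I) (x : {ffun J -> I}) :
  independent_uniform P xi ->
  measurable ((fun w => [ffun j => xi j w]) @^-1` [set x]) /\
  P ((fun w => [ffun j => xi j w]) @^-1` [set x]) = (#|I|%:R ^- #|J|)%:E.
Proof.
move=> [mxi unif indep].
have -> : (fun w => [ffun j => xi j w]) @^-1` [set x] =
    \bigcap_(j in [set` [set: J]%SET]) (xi j @^-1` [set x j]).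
  apply/seteqP; split => w /=.
    by move=> <- j _; rewrite /= ffunE.
  by move=> h; apply/ffunP => j; rewrite ffunE; apply: h; rewrite /= inE.
split; first by apply: fin_bigcap_measurable => // j _; exact: mxi.
rewrite indep (eq_bigr (fun=> (#|I|%:R^-1 : R)%:E)) => [|j _]; last exact: unif.
by rewrite prodEFin prodr_const cardsT exprVn.
Qed.

(** * The convergence rate *)

Theorem theorem4p1 (R : realType) (m n : nat)
  (M : set 'M[R]_(m, n)) (hM : embedded_submanifold M)
  (g : 'M[R]_(m, n) -> 'M[R]_(m, n) -> 'M[R]_(m, n) -> R)
  (hg : riemannian_metric M g)
  (f : 'M[R]_(m, n) -> R) (hf : forall X, M X -> differentiable f X)
  (rgrad : 'M[R]_(m, n) -> 'M[R]_(m, n)) (hrgrad : is_rgrad M g f rgrad)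
  (Retr : 'M[R]_(m, n) -> 'M[R]_(m, n) -> 'M[R]_(m, n))
  (hRetr : retraction M Retr)
  (I : finType) (B : I -> 'M[R]_(m, n) -> 'M[R]_(m, n))
  (hB : spans_tangent M B)
  (fstar : R) (hfstar : is_minimum M f fstar)
  (XX : set 'M[R]_(m, n)) (hXX : compact_neighbourhood_in M XX)
  (hcrit : exists2 Xc, XX Xc & rgrad Xc = 0)
  (cb cp L : R) (hcb : 0 < cb) (hcp : 0 < cp) (hL : 0 < L)
  (hA1 : basis_bounds M XX g B cb cp)
  (hA2 : retraction_smooth M XX g Retr f rgrad L)
  (X0 : 'M[R]_(m, n)) (hX0 : M X0) (K : nat) (hK : (1 <= K)%N)
  (eta : R) (heta : eta = 1 / (L * cb))
  (d : measure_display) (Omega : measurableType d) (P : probability Omega R)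
  (ell : nat -> nat -> Omega -> I)
  (hell : independent_uniform P (fun p : 'I_K * 'I_1 => ell p.1 p.2))
  (hiter : forall (w : Omega) (k s : nat), (k < K)%N -> (s <= 1)%N ->
     XX (rcd_iterate Retr f B eta 1 X0 (fun k' s' => ell k' s' w) k s)) :
  (\big[Order.min/+oo%E]_(k < K)
     'E_P[fun w : Omega =>
            let Xk := rcd_iterate Retr f B eta 1 X0 (fun k' s' => ell k' s' w) k 0 in
            (rnorm g Xk (rgrad Xk) ^+ 2)%R]
   <= (2 * L * cb ^+ 2 * cp^-1 * #|I|%:R * (f X0 - fstar) / K%:R)%:E)%E.
Proof.
have sXM : XX `<=` M by case: hXX.
have [_ hmin] := hfstar.
case: K hK hell hiter => [//|K] _ hell hiter.
pose choice w : {ffun 'I_K.+1 * 'I_1 -> I} :=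
  [ffun p : 'I_K.+1 * 'I_1 => ell p.1 p.2 w].
pose path (x : {ffun 'I_K.+1 * 'I_1 -> I}) (k s : nat) := x (inord k, inord s).
have pathE w k s : (k < K.+1)%N -> (s < 1)%N ->
    ell k s w = path (choice w) k s.
  by move=> kK s1; rewrite /path ffunE /= !inordK.
pose X x k := rcd_iterate Retr f B eta 1 X0 (path x) k 0.
have XE w k : (k <= K.+1)%N ->
    rcd_iterate Retr f B eta 1 X0 (fun k' s' => ell k' s' w) k 0
    = X (choice w) k.
  move=> kK; apply: rcd_outer_eq_prefix => j s jk s1.
  by rewrite pathE//; exact: leq_trans kK.
set N := #|{: {ffun 'I_K.+1 * 'I_1 -> I}}|.
have joint x := independent_uniform_joint x hell.
have I0 : (0 < #|I|)%N.
  have [w _] : [set: Omega] !=set0.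
    apply/set0P/negP => /eqP e; have := @probability_setT _ _ _ P.
    by rewrite e measure0 => /eqP; rewrite eqe eq_sym oner_eq0.
  by apply/card_gt0P; exists (ell 0 0 w).
have NE : N%:R = #|I|%:R ^+ #|{: 'I_K.+1 * 'I_1}| :> R.
  by rewrite /N card_ffun natrX.
have N0 : 0 < N%:R :> R by rewrite NE exprn_gt0// ltr0n.
(* The event that the drawn indices are x has probability 1 / N, so it contains
   an outcome, to which hiter applies. *)
have XXX x k : (k <= K.+1)%N -> XX (X x k).
  move=> kK.
  have [w xw] : choice @^-1` [set x] !=set0.
    apply/set0P/negP => /eqP e; have [_] := joint x.
    rewrite -/choice e measure0 => /eqP; rewrite eqe -NE eq_sym invr_eq0.
    by rewrite gt_eqF.
  rewrite -xw -XE//; case: k kK => [|k] kK.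
    by apply: (hiter w 0 0).
  (* Membership of the last point X_K is the case s = 1 of hiter, since
     X_k^1 and X_(k+1) are the same point. *)
  exact: (hiter w k 1%N).
pose G x k := rnorm g (X x k) (rgrad (X x k)) ^+ 2.
have meanE (k : 'I_K.+1) :
    ('E_P[fun w : Omega =>
       let Xk := rcd_iterate Retr f B eta 1 X0 (fun k' s' => ell k' s' w) k 0 in
       (rnorm g Xk (rgrad Xk) ^+ 2)%R] = (N%:R^-1 * \sum_x G x k)%:E)%E.
  transitivity ('E_P[(fun x => G x k) \o choice])%E.
    by congr expectation; apply/funext => w /=; rewrite XE// ltnW.
  rewrite expectation_finite_range; last 2 first.
  - by move=> x; case: (joint x).
  - by move=> x; exact: sqr_ge0.
  rewrite mulr_sumr -sumEFin; apply: eq_bigr => x _.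
  by case: (joint x) => _ ->; rewrite NE -EFinM mulrC.
pose D x k l := basis_deriv f B (X x k) l ^+ 2.
have resample (k : 'I_K.+1) :
    \sum_x \sum_l D x k l = (\sum_x D x k (path x k 0)) *+ #|I|.
  rewrite (sum_resample (k := (k, ord0)) (F := fun x => D x k)) => [|x y xy l].
    congr (_ *+ _); apply: eq_bigr => x _; congr (D x k (x (_, _))).
      by rewrite inord_val.
    by apply/val_inj; rewrite /= inordK.
  (* X_k is determined by the indices drawn at steps j < k, so changing the
     k-th one leaves it unchanged. *)
  rewrite /D; congr (basis_deriv _ _ _ _ ^+ 2).
  apply: rcd_outer_eq_prefix => j s jk _; apply: xy.
  apply/eqP => -[/(congr1 val)].
  rewrite /= inordK; last exact: ltn_trans (ltn_ord k).
  by move=> e; rewrite e ltnn in jk.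
have descent x :
    \sum_(k < K.+1) D x k (path x k 0) <= 2 * L * cb * (f X0 - fstar).
  have := rcd_sum_basis_deriv (X0 := X0) (l := path x) (K := K.+1)
            hg hrgrad hB sXM hcb hL hA1 hA2 hmin.
  by rewrite -heta; apply => k; exact: XXX.
have total : cp * \sum_(k < K.+1) \sum_x G x k <=
    cb * (#|I|%:R * (N%:R * (2 * L * cb * (f X0 - fstar)))).
  apply: (@le_trans _ _ (cb * \sum_(k < K.+1) \sum_x \sum_l D x k l)).
    rewrite !mulr_sumr; apply: ler_sum => k _; rewrite !mulr_sumr.
    apply: ler_sum => x _.
    by apply: (rgrad_le_basis_deriv hg hrgrad hB sXM hA1); apply: XXX; rewrite ltnW.
  rewrite ler_wpM2l ?(ltW hcb)//.
  rewrite (eq_bigr _ (fun k _ => resample k)) sumrMnl exchange_big /= mulr_natl.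
  rewrite lerMn2r; apply/orP; right.
  rewrite [leRHS](_ : _ = \sum_(x : {ffun 'I_K.+1 * 'I_1 -> I})
                            2 * L * cb * (f X0 - fstar)).
    by apply: ler_sum => x _; exact: descent.
  by rewrite sumr_const mulr_natl.
set c := (X in (_ <= X%:E)%E).
have [|k hk] := @exists_le_average R K.+1
    (fun k => N%:R^-1 * \sum_x G x k) c isT; last first.
  by apply: (bigmin_inf k) => //; rewrite meanE lee_fin.
rewrite -mulr_sumr -(ler_pM2l (mulr_gt0 hcp N0)).
rewrite [leLHS](_ : _ = cp * \sum_(k < K.+1) \sum_x G x k); last first.
  by field; rewrite gt_eqF.
apply: le_trans total _; rewrite /c le_eqVlt; apply/orP; left; apply/eqP.
by field; rewrite ?gt_eqF ?ltr0n.
Qed.
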